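(* Let $(M,d)$ be a compact metric space. Let $\nu$ be a Borel probability measure on $C(M)$ whose topological support $\mathcal{G}$ is $\varrho_\infty$-bounded. Assume that the random dynamical system induced by $\nu$ is weakly contracting on average, i.e. $\lambda_\nu<\infty$. Let $\eta$ be the (unique) $\nu$-stationary probability measure on $M$. Then, for every Lipschitz function $h:M\to\mathbb{R}$, all $x\in M$, all $n\in\mathbb{N}$, and all $t>\frac{2\lambda_\nu\operatorname{L}(h)}{n}$, $$\mathbb{P}\left(\left|\kappa(\mathcal{E}_n(x),\eta)-\mathbb{E}\left[\kappa(\mathcal{E}_n(x),\eta)\right]\right|>t\right)\le2\exp\left(-\frac{nt^2}{12(|\mathcal{G}|_\infty+\lambda_\nu)^2}\right).$$
   Context: $C(M)$ is the space of continuous maps $M\to M$ with the metric $\varrho_\infty(f,g)=\sup_{x\in M}d(f(x),g(x))$; $|\mathcal{G}|_\infty=\sup_{f,g\in\mathcal{G}}\varrho_\infty(f,g)$, and $\mathcal{G}$ is $\varrho_\infty$-bounded if this is finite. $(\Omega,\mathbb{P})=(\mathcal{G}^{\mathbb{N}},\nu^{\mathbb{N}})$, with expectation $\mathbb{E}$; for $\omega=(f_1,f_2,\dots)$, $X_n^x[\omega]=f_n\circ\cdots\circ f_1(x)$, $X_0^x=x$. $\lambda_\nu=\sup_{x,y\in M}\sum_{n=0}^\infty\mathbb{E}[d(X_n^x,X_n^y)]$. A Borel probability measure $\eta$ on $M$ is $\nu$-stationary if $\eta(A)=\int_{\mathcal{G}}\eta(f^{-1}A)\,d\nu(f)$ for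 all Borel $A\subset M$. $\operatorname{L}(h)=\sup_{x\ne x'}\frac{|h(x)-h(x')|}{d(x,x')}$. $\mathcal{E}_n(x)=\frac1n\sum_{j=0}^{n-1}\delta_{X_j^x}$. $\kappa(\eta_1,\eta_2)=\sup\{\int g\,d\eta_1-\int g\,d\eta_2: g:M\to\mathbb{R}\text{ is 1-Lipschitz}\}$ is the Kantorovich distance. *)

(* Defs.v *)
From HB Require Import structures.
From mathcomp Require Import all_boot all_order all_algebra.
From mathcomp Require Import all_classical all_reals all_analysis.

Set Implicit Arguments.
Unset Strict Implicit.
Unset Printing Implicit Defensive.
Import Order.TTheory GRing.Theory Num.Theory.
Import numFieldNormedType.Exports.

Local Open Scope classical_set_scope.
Local Open Scope ring_scope.

(* Measurable types of the library are pointed, so a metric space carrying a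
   Borel sigma-algebra has to come with a point, i.e. be nonempty. *)
#[short(type="pmetricType")]
HB.structure Definition PointedMetric (K : numDomainType) :=
  {M of Pointed M & Metric K M}.

Notation borel T := (g_sigma_algebraType (@open T)).

Definition cmap (R : realType) (M : pmetricType R) := continuousType M M.

Section cmap_metric.
Context {R : realType} {M : pmetricType R}.

(* The uniform distance takes values in \bar R; it is finite when M is
   compact, and its balls induce the pseudometric structure of cmap M. *)
Definition rho (f g : cmap M) : \bar R :=
  ereal_sup (range (fun x : M => (mdist (f x) (g x))%:E)).

Definition rho_ball (f : cmap M) (e : R) : set (cmap M) :=
  [set g | (rho f g < e%:E)%E].

HB.instance Definition _ := Choice.copy (cmap M) (continuousType M M).
HB.instance Definition _ := isPointed.Build (cmap M) (idfun : continuousType M M).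
HB.instance Definition _ := hasNbhs.Build (cmap M) (nbhs_ (entourage_ rho_ball)).

Let rho_ball_center f (e : R) : 0 < e -> rho_ball f e f.
Proof.
move=> e0; rewrite /rho_ball/= (@le_lt_trans _ _ 0%E) ?lte_fin//.
by apply: ge_ereal_sup => _ [x _ <-]; rewrite mdistxx.
Qed.

Let rho_ball_sym f g (e : R) : rho_ball f e g -> rho_ball g e f.
Proof.
rewrite /rho_ball/= /rho; under eq_fun do rewrite metric_sym.
by [].
Qed.

Let rho_ball_triangle f g h (e1 e2 : R) :
  rho_ball f e1 g -> rho_ball g e2 h -> rho_ball f (e1 + e2) h.
Proof.
rewrite /rho_ball/= => fg gh; rewrite EFinD.
apply: le_lt_trans (lteD fg gh).
apply: ge_ereal_sup => _ [x _ <-].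
apply: (@le_trans _ _ ((mdist (f x) (g x))%:E + (mdist (g x) (h x))%:E)%E).
  by rewrite -EFinD lee_fin metric_triangle.
by apply: leeD; apply: ereal_sup_ubound; exists x.
Qed.

HB.instance Definition _ := @Nbhs_isPseudoMetric.Build R (cmap M)
  (entourage_ rho_ball) erefl rho_ball rho_ball_center rho_ball_sym
  rho_ball_triangle erefl.

End cmap_metric.

Section sequence_space.
Context {d : measure_display} (T : measurableType d).

Definition cylinders : set (set (nat -> T)) :=
  [set C | exists i, exists2 B, measurable B & C = (fun w => w i) @^-1` B].

Definition seq_space := g_sigma_algebraType cylinders.

HB.instance Definition _ := Measurable.on seq_space.

(* P is the product measure nu^N: it is determined by its values on the finite
   rectangles. *)
Definition is_power_law (R : realType) (nu : probability T R)
    (P : probability seq_space R) : Prop :=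
  forall (n : nat) (A : nat -> set T), (forall i, measurable (A i)) ->
    P [set w | forall i, (i < n)%N -> A i (w i)] =
    (\prod_(i < n) nu (A i))%E.

End sequence_space.

Section rds.
Context {R : realType} {M : pmetricType R}.
Implicit Types (nu : probability (borel (cmap M)) R)
  (P : probability (seq_space (borel (cmap M))) R).
Local Open Scope ereal_scope.

Definition topo_support nu : set (cmap M) :=
  [set f | forall U : set (cmap M), open U -> U f -> 0 < nu U].

Definition rho_diam (G : set (cmap M)) : \bar R :=
  ereal_sup [set rho f g | f in G & g in G].

(* The n-th map f_n of a sequence (f_1, f_2, ...) is w n.-1. *)
Fixpoint orbit_pt (w : nat -> cmap M) (n : nat) (x : M) : M :=
  if n is m.+1 then w m (orbit_pt w m x) else x.

Definition lambda P : \bar R :=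
  ereal_sup (range (fun xy : M * M => \sum_(0 <= n <oo)
    'E_P[fun w => mdist (orbit_pt w n xy.1) (orbit_pt w n xy.2)])).

Definition stationary nu (eta : probability (borel M) R) : Prop :=
  forall A : set (borel M), measurable A ->
    eta A = \int[nu]_(f in topo_support nu) eta ((f : cmap M) @^-1` A).

End rds.

Section lipschitz_kantorovich.
Context {R : realType} {M : pmetricType R}.

Definition kLipschitz (k : R) (h : M -> R) : Prop :=
  forall x y, `|h x - h y| <= k * mdist x y.

Definition Lipschitz (h : M -> R) : Prop := exists k, kLipschitz k h.

(* Real supremum: the set is bounded for Lipschitz h, and sup set0 = 0 when M
   is a singleton. *)
Definition lip_const (h : M -> R) : R :=
  sup [set z | exists x y, x != y /\ z = `|h x - h y| / mdist x y].

(* Real supremum: on a compact M the set is bounded for measures of mass 1. *)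
Definition kantorovich (eta1 eta2 : {measure set (borel M) -> \bar R}) : R :=
  sup [set Rintegral eta1 setT g - Rintegral eta2 setT g | g in kLipschitz 1].

Definition empirical (w : nat -> cmap M) (n : nat) (x : M) :
    {measure set (borel M) -> \bar R} :=
  mscale (n%:R^-1)%:nng (msum (fun j => dirac (orbit_pt w j x : borel M)) n).

End lipschitz_kantorovich.

(* Main.v *)
(* Write the Kantorovich distance as [Psi (X_0, ..., X_{n-1})], where [Psi] is
   [1/n]-Lipschitz for the l1-distance on trajectories.  Averaging over the
   future and changing only the current map [f_k] moves the starting point of
   the remaining orbit, so it changes the conditional expectation by at most
   [lambda / n]: the martingale differences are bounded although the function
   itself need not have bounded differences.  Peeling off one map at a time
   with [expR y <= y + expR (3 y^2)] gives the moment generating function bound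
   [exp (3 s^2 lambda^2 / n)], and Chernoff's bound with
   [s = n t / (6 lambda^2)] gives the constant 12. *)

Require Import Defs.
From HB Require Import structures.
From mathcomp Require Import all_boot all_order all_algebra.
From mathcomp Require Import all_classical all_reals all_analysis.
From mathcomp Require Import measurable_realfun ring lra.

Set Implicit Arguments.
Unset Strict Implicit.
Unset Printing Implicit Defensive.
Import Order.TTheory GRing.Theory Num.Theory.
Import numFieldNormedType.Exports.

Local Open Scope classical_set_scope.
Local Open Scope ring_scope.

(** * Exponential moments of bounded functions *)

Section subgaussian.
Context {R : realType}.

(** The linear term vanishes on integrating a centred variable, which leaves a purely quadratic
    exponent. For [y <= 1/3] the chain is [expR y <= 1 / (1 - y) <= 1 + y + 3 y^2 <= y + expR (3
    y^2)]; for [y > 1/3] already [y <= 3 y^2]. *)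
Lemma expR_le_subgaussian (y : R) : expR y <= y + expR (3 * y ^+ 2).
Proof.
have key : y < 1 -> 0 <= 2 * y ^+ 2 - 3 * y ^+ 3 -> expR y <= y + expR (3 * y ^+ 2).
  move=> y1 hy; apply: (@le_trans _ _ (1 - y)^-1).
    have h := expR_ge1Dx (- y).
    by rewrite -[y in expR y]opprK expRN lef_pV2 ?posrE ?expR_gt0 ?subr_gt0.
  have h2 := expR_ge1Dx (3 * y ^+ 2).
  apply: (@le_trans _ _ (y + (1 + 3 * y ^+ 2))); last by rewrite lerD2l.
  rewrite -[X in X <= _]mul1r ler_pdivrMr ?subr_gt0//.
  by rewrite -subr_ge0 (_ : _ - 1 = 2 * y ^+ 2 - 3 * y ^+ 3)//; ring.
have [y13|y13] := leP y (1/3).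
  by apply: key; nra.
apply: (@le_trans _ _ (expR (3 * y ^+ 2))); last by rewrite lerDr; nra.
by rewrite ler_expR; nra.
Qed.

End subgaussian.

Section bounded_measurable.
Context d (T : measurableType d) (R : realType).
Implicit Types f g : T -> R.

(** All random variables below are bounded because [M] is compact. This class is stable under the
    operations in use and integrable for finite measures, so integrability reduces to closure
    properties. *)
Definition bmeasurable f :=
  measurable_fun setT f /\ exists C, forall x, `|f x| <= C.

Lemma bmeasurable_cst c : bmeasurable (fun=> c).
Proof. by split; [exact: measurable_cst|exists `|c|]. Qed.

Lemma bmeasurableD f g : bmeasurable f -> bmeasurable g ->
  bmeasurable (fun x => f x + g x).
Proof.
move=> [mf [C fC]] [mg [D gD]]; split; first exact: measurable_funD.
by exists (C + D) => x; rewrite (le_trans (ler_normD _ _))// lerD.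
Qed.

Lemma bmeasurableM f g : bmeasurable f -> bmeasurable g ->
  bmeasurable (fun x => f x * g x).
Proof.
move=> [mf [C fC]] [mg [D gD]]; split; first exact: measurable_funM.
by exists (C * D) => x; rewrite normrM ler_pM.
Qed.

Lemma bmeasurableB f g : bmeasurable f -> bmeasurable g ->
  bmeasurable (fun x => f x - g x).
Proof.
move=> [mf [C fC]] [mg [D gD]]; split; first exact: measurable_funB.
by exists (C + D) => x; rewrite (le_trans (ler_normB _ _))// lerD.
Qed.

Lemma bmeasurable_expR f : bmeasurable f -> bmeasurable (fun x => expR (f x)).
Proof.
move=> [mf [C fC]]; split; first exact: measurableT_comp.
exists (expR C) => x; rewrite ger0_norm ?expR_ge0// ler_expR.
exact: le_trans (ler_norm _) (fC x).
Qed.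

Lemma bmeasurable_norm f : bmeasurable f -> bmeasurable (fun x => `|f x|).
Proof.
move=> [mf [C fC]]; split; first exact: measurableT_comp.
by exists C => x; rewrite normr_id.
Qed.

Lemma bmeasurable_sum n (F : nat -> T -> R) : (forall i, bmeasurable (F i)) ->
  bmeasurable (fun x => \sum_(i < n) F i x).
Proof.
move=> bF; elim: n => [|n IH].
  rewrite (_ : (fun _ => _) = fun=> 0); first exact: bmeasurable_cst.
  by apply/funext => x; rewrite big_ord0.
rewrite (_ : (fun _ => _) = fun x => (\sum_(i < n) F i x) + F n x).
  exact: bmeasurableD.
by apply/funext => x; rewrite big_ord_recr.
Qed.

Lemma bmeasurable_integrable (mu : {finite_measure set T -> \bar R}) f :
  bmeasurable f -> mu.-integrable setT (EFin \o f).
Proof.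
move=> [mf [C fC]]; apply: measurable_bounded_integrable => //.
  by rewrite -ge0_fin_numE// fin_num_measure.
exists C; split; first exact: num_real.
by move=> D CD x _; exact: le_trans (fC x) (ltW CD).
Qed.

End bounded_measurable.
#[global] Hint Resolve bmeasurable_cst : core.

Section probability_integral.
Context d (T : measurableType d) (R : realType) (mu : probability T R).
Implicit Types f g : T -> R.

Lemma prob_Rintegral_cst c : \int[mu]_x c = c.
Proof.
rewrite Rintegral_cst// (_ : fine _ = 1) ?mulr1//.
exact: (congr1 fine (probability_setT mu)).
Qed.

Lemma prob_Rintegral_sum n (F : nat -> T -> R) : (forall i, bmeasurable (F i)) ->
  \int[mu]_x (\sum_(i < n) F i x) = \sum_(i < n) \int[mu]_x (F i x).
Proof.
move=> bF; elim: n => [|n IH].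
  under eq_Rintegral do rewrite big_ord0.
  by rewrite big_ord0 prob_Rintegral_cst.
under eq_Rintegral do rewrite big_ord_recr.
rewrite RintegralD//; try exact: bmeasurable_integrable; last first.
  exact: (bmeasurable_integrable mu (bmeasurable_sum n bF)).
by rewrite IH big_ord_recr.
Qed.

Lemma prob_Rintegral_le f g : bmeasurable f -> bmeasurable g ->
  (forall x, f x <= g x) -> \int[mu]_x f x <= \int[mu]_x g x.
Proof. by move=> bf bg fg; apply: le_Rintegral => //; exact: bmeasurable_integrable. Qed.

(** A form of Hoeffding's lemma with a weaker constant, in terms of the oscillation of [X] rather
    than of an interval containing its values. *)
Lemma subgaussian_step (X : T -> R) (s c : R) : bmeasurable X ->
  (forall x y, `|X x - X y| <= c) ->
  \int[mu]_x expR (s * (X x - \int[mu]_y X y)) <= expR (3 * (s * c) ^+ 2).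
Proof.
move=> bX Xc; set m := \int[mu]_y X y.
have iX := bmeasurable_integrable mu bX.
have Xm x : `|X x - m| <= c.
  (* The deviation from the mean is an average of differences of values, so the oscillation bounds
     it. *)
  have -> : X x - m = \int[mu]_y (X x - X y).
    rewrite RintegralB// ?prob_Rintegral_cst//.
    exact: (bmeasurable_integrable mu (@bmeasurable_cst _ _ _ (X x))).
  have bXx : bmeasurable (fun y => X x - X y) by exact: bmeasurableB.
  apply: (le_trans (le_normr_Rintegral measurableT (bmeasurable_integrable mu bXx))).
  rewrite -[leRHS]prob_Rintegral_cst; apply: prob_Rintegral_le => //.
  exact: bmeasurable_norm.
have bsX : bmeasurable (fun x => s * (X x - m)).
  by apply: bmeasurableM => //; exact: bmeasurableB.
(* Pointwise subgaussian bound with [(X x - m)^2] replaced by [c^2]; the remaining linear part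
   integrates to zero. *)
apply: (@le_trans _ _ (\int[mu]_x (s * (X x - m) + expR (3 * (s * c) ^+ 2)))).
  apply: prob_Rintegral_le; [exact: bmeasurable_expR|exact: bmeasurableD|move=> x].
  apply: (le_trans (expR_le_subgaussian _)).
  rewrite lerD2l ler_expR ler_pM2l// !exprMn ler_wpM2l ?sqr_ge0//.
  by rewrite -[leLHS]real_normK ?num_real// lerXn2r ?nnegrE// (le_trans _ (Xm x)).
rewrite RintegralD//; [|exact: bmeasurable_integrable..].
rewrite prob_Rintegral_cst RintegralZl//; last first.
  by apply: bmeasurable_integrable; exact: bmeasurableB.
by rewrite RintegralB//; [rewrite prob_Rintegral_cst subrr mulr0 add0r|
  exact: bmeasurable_integrable].
Qed.

Lemma chernoff_bounded (X : T -> R) (s t : R) : 0 < s -> bmeasurable X ->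
  (mu [set x | (t <= X x)%R] <= (\int[mu]_x expR (s * X x) * expR (- (s * t)))%:E)%E.
Proof.
move=> s0 bX; have [mX _] := bX.
pose X' : {RV mu >-> R} := HB.pack X (isMeasurableFun.Build _ _ _ _ X mX).
apply: (le_trans (@chernoff _ _ _ mu X' s t s0)).
rewrite EFinM /mmt_gen_fun unlock /Rintegral fineK//.
  by under eq_integral do rewrite /= mulrC.
apply: integrable_fin_num => //; apply: (bmeasurable_integrable mu).
by apply: bmeasurable_expR; exact: bmeasurableM.
Qed.

End probability_integral.

(** * The product measure as an independent first coordinate *)

Section power_law.
Context d (T : measurableType d).

Definition seq_cons (f : T) (w : seq_space T) : seq_space T :=
  fun i => if i is j.+1 then w j else f.

Lemma measurable_coord i : measurable_fun setT (fun w : seq_space T => w i).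
Proof.
move=> _ B mB; rewrite setTI; apply: sub_sigma_algebra.
by exists i, B.
Qed.

Lemma measurable_seq_cons :
  measurable_fun setT (fun fw : T * seq_space T => seq_cons fw.1 fw.2).
Proof.
apply: (@measurability _ _ (T * seq_space T)%type (seq_space T) setT
  (fun fw => seq_cons fw.1 fw.2) (@cylinders _ T) erefl).
move=> _ [_ [i [B mB ->]] <-]; rewrite setTI.
case: i => [|i].
- have := @measurable_fst _ _ T (seq_space T) measurableT _ mB.
  by rewrite setTI.
- have := measurableT_comp (measurable_coord i) (@measurable_snd _ _ T (seq_space T)).
  by move=> /(_ measurableT _ mB); rewrite setTI.
Qed.

(** The sets on which [is_power_law] prescribes [P]. Unlike the one-coordinate cylinders they are
    closed under intersection, as uniqueness of measures requires of a generator. *)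
Definition boxes : set (set (seq_space T)) :=
  [set C | exists n A, (forall i, measurable (A i : set T)) /\
    C = [set w | forall i, (i < n)%N -> A i (w i)]].

Lemma measurable_box n (A : nat -> set T) : (forall i, measurable (A i)) ->
  measurable [set w : seq_space T | forall i, (i < n)%N -> A i (w i)].
Proof.
move=> mA; rewrite (_ : [set _ | _] =
    \bigcap_(i in `I_n) (fun w : seq_space T => w i) @^-1` A i).
  apply: bigcap_measurableType => i _; rewrite -[_ @^-1` _]setTI.
  exact: (measurable_coord i).
by apply/seteqP; split => w /= h i; exact: h.
Qed.

Lemma setI_closed_boxes : setI_closed boxes.
Proof.
move=> _ _ [n [A [mA ->]]] [m [B [mB ->]]].
(* Padding by [setT] beyond the original length lets both boxes be read at the common length
   [maxn n m]. *)
pose A' i := if (i < n)%N then A i else setT.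
pose B' i := if (i < m)%N then B i else setT.
exists (maxn n m), (fun i => A' i `&` B' i); split.
  move=> i; apply: measurableI; rewrite /A' /B'; case: ifP => //.
apply/seteqP; split=> w /=.
- move=> [hA hB] i _; split; rewrite /A' /B'; case: ifPn => // ?; auto.
- move=> h; split => i im; have [] := h i.
  + by rewrite leq_max im.
  + by rewrite /A' im.
  + by rewrite leq_max im orbT.
  + by rewrite /B' im.
Qed.

Lemma seq_space_boxes : @measurable _ (seq_space T) = <<s boxes >>.
Proof.
apply/seteqP; split.
- apply: smallest_sub; first exact: smallest_sigma_algebra.
  move=> _ [i [B mB ->]]; apply: sub_sigma_algebra.
  exists i.+1, (fun j => if j == i then B else setT); split.
    by move=> j; case: ifP.
  apply/seteqP; split=> w /=; first by move=> wB j _; case: eqP => // ->.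
  by move=> /(_ i (ltnSn i)); rewrite eqxx.
- apply: smallest_sub; first exact: sigma_algebra_measurable.
  by move=> _ [n [A [mA ->]]]; exact: measurable_box.
Qed.

Variables (R : realType) (nu : probability T R) (P : probability (seq_space T) R).
Hypothesis hP : is_power_law nu P.

(** The preimage of a nonempty-length box under [seq_cons] is a rectangle: its first side times the
    box of the remaining sides. The first factor of the product thus splits off. *)
Let power_law_box n (B : nat -> set T) : (forall i, measurable (B i)) ->
  (\prod_(i < n) nu (B i))%E = (nu \x P)%E ((fun fw => seq_cons fw.1 fw.2) @^-1`
    [set w | forall i, (i < n)%N -> B i (w i)]).
Proof.
move=> mB; case: n => [|n].
  rewrite (_ : _ @^-1` _ = setT `*` setT); last by apply/seteqP; split.
  rewrite product_measure1E// big_ord0 -[LHS]mule1.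
  by congr (_ * _)%E; apply/esym; exact: probability_setT.
rewrite (_ : _ @^-1` _ = B 0%N `*`
    [set w | forall i, (i < n)%N -> B i.+1 (w i)]); last first.
  apply/seteqP; split => [[f w]/= h|[f w]/= [h0 h] [|i]]//; last exact: h.
  by split; [exact: (h 0%N)|move=> i ni; exact: (h i.+1)].
rewrite product_measure1E//; last exact: (measurable_box n (fun i => mB i.+1)).
rewrite big_ord_recl; congr (_ * _)%E; apply/esym.
exact: (hP n (fun i => mB i.+1)).
Qed.

(** The first map is independent of the shifted sequence, which again has law [P]. Both sides are
    finite measures agreeing on a generating pi-system. *)
Lemma power_law_cons A : measurable A ->
  P A = (nu \x P)%E ((fun fw => seq_cons fw.1 fw.2) @^-1` A).
Proof.
pose phi : {mfun (T * seq_space T)%type >-> seq_space T} :=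
  HB.pack (fun fw : T * seq_space T => seq_cons fw.1 fw.2)
    (isMeasurableFun.Build _ _ _ _ _ measurable_seq_cons).
move=> mA; change (P A = pushforward (nu \x P)%E phi A).
apply: (measure_unique boxes (fun=> setT)) => //.
- exact: seq_space_boxes.
- exact: setI_closed_boxes.
- by move=> _; exists 0%N, (fun=> setT); split => //; apply/seteqP; split.
- by rewrite bigcup_const.
- move=> _ [n [B [mB ->]]].
  transitivity (\prod_(i < n) nu (B i))%E; first exact: hP.
  exact: power_law_box.
- by move=> _; exact: (le_lt_trans (probability_le1 P measurableT) (ltry 1)).
Qed.

Section expectation_cons.
Variable F : seq_space T -> R.
Hypothesis bF : bmeasurable F.

Let bF2 : bmeasurable (fun fw : T * seq_space T => F (seq_cons fw.1 fw.2)).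
Proof.
have [mF [C FC]] := bF; split; last by exists C.
exact: (measurableT_comp mF measurable_seq_cons).
Qed.

Lemma bmeasurable_seq_cons f : bmeasurable (fun w => F (seq_cons f w)).
Proof.
have [mF [C FC]] := bF2; split; first exact: (measurable_fun_pair2 f mF).
by exists C => x; exact: (FC (f, x)).
Qed.

Let iF2 : (nu \x P)%E.-integrable setT
  (EFin \o (fun fw : T * seq_space T => F (seq_cons fw.1 fw.2))).
Proof.
pose Q : probability (T * seq_space T)%type R := (nu \x P)%E.
exact: (bmeasurable_integrable Q bF2).
Qed.

Lemma bmeasurable_expectation_cons :
  bmeasurable (fun f => \int[P]_w F (seq_cons f w)).
Proof.
split.
  have := measurable_fubini_F iF2.
  by apply: measurableT_comp.
have [_ [C FC]] := bF2; exists C => f.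
have bf := bmeasurable_seq_cons f.
apply: (le_trans (le_normr_Rintegral measurableT (bmeasurable_integrable P bf))).
rewrite -[leRHS](prob_Rintegral_cst P); apply: prob_Rintegral_le => //.
  exact: bmeasurable_norm.
by move=> w; exact: (FC (f, w)).
Qed.

(** Conditioning on the first map: change of variables along [seq_cons], then Fubini. *)
Lemma expectation_cons :
  \int[P]_w F w = \int[nu]_f \int[P]_w F (seq_cons f w).
Proof.
rewrite /Rintegral; congr fine.
transitivity (\int[nu]_f \int[P]_w (F (seq_cons f w))%:E)%E; last first.
  apply: eq_integral => f _; rewrite fineK//; apply: integrable_fin_num => //.
  exact: (bmeasurable_integrable P (bmeasurable_seq_cons f)).
rewrite (integral12_prod_meas1 iF2).
pose phi : {mfun (T * seq_space T)%type >-> seq_space T} :=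
  HB.pack (fun fw : T * seq_space T => seq_cons fw.1 fw.2)
    (isMeasurableFun.Build _ _ _ _ _ measurable_seq_cons).
rewrite (@eq_measure_integral _ _ _ _ (pushforward (nu \x P)%E phi)); last first.
  by move=> A mA _; exact: power_law_cons.
rewrite integral_pushforward//.
by have [mF _] := bF; exact/measurable_EFinP.
Qed.

End expectation_cons.
End power_law.

(** * Measurability of orbits by discretization *)

Section discretization.
Context {R : realType} {M : pmetricType R}.

Lemma exists_dense_seq : compact [set: M] ->
  exists E : nat -> M, forall z e, 0 < e -> exists i, mdist (E i) z < e.
Proof.
move=> /compact_second_countable[B /countable_injP[g gI] [Bo Bb]].
exists (fun i => get [set z : M | exists2 U, B U /\ g U = i & U z]) => z e e0.
have [U [BU Uz] Ue] := Bb z _ (nbhsx_ballx z e e0).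
exists (g U).
have : exists y, [set z : M | exists2 V, B V /\ g V = g U & V z] y.
  by exists z; exists U.
move=> /getPex[V [BV gVU]].
have -> : V = U by apply: gI => //; rewrite inE.
by move=> /Ue; rewrite ballEmdist/= metric_sym.
Qed.

(** Evaluation at a point does not increase distances from the uniform metric, so preimages of open
    sets are open. *)
Lemma measurable_eval (y : M) :
  measurable_fun setT (fun f : borel (cmap M) => (f : cmap M) y : borel M).
Proof.
apply: (@measurability _ _ (borel (cmap M)) (borel M) setT _ (@open M) erefl).
move=> _ [U oU <-]; rewrite setTI; apply: sub_sigma_algebra.
change (open ((fun f : cmap M => f y) @^-1` U)).
rewrite openE => f /= Uf; move: oU; rewrite openE => /(_ _ Uf).
rewrite /interior => /nbhs_ballP[e /= e0 He].
apply/nbhs_ballP; exists e => // g fg; apply: He.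
rewrite ballEmdist/= -lte_fin; apply: le_lt_trans fg.
by apply: ereal_sup_ubound; exists y.
Qed.

Variable E : nat -> M.
Hypothesis dE : forall z e, 0 < e -> exists i, mdist (E i) z < e.

Let invS_gt0 k : 0 < k.+1%:R^-1 :> R. Proof. by []. Qed.

Definition quantize k (z : M) : nat := ex_minn (dE z (invS_gt0 k)).

Lemma quantize_near k z : mdist (E (quantize k z)) z < k.+1%:R^-1.
Proof. by rewrite /quantize; case: ex_minnP. Qed.

(** Since [quantize] takes the least admissible index, its level set is the [i]-th ball minus the
    earlier ones. *)
Lemma measurable_quantize k i :
  measurable ([set z | quantize k z = i] : set (borel M)).
Proof.
pose b j : set (borel M) := [set z : M | mdist (E j) z < k.+1%:R^-1].
have mb j : measurable (b j).
  apply: sub_sigma_algebra; rewrite /b -ballEmdist.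
  rewrite openE => z; rewrite ballEmdist/= => Ez.
  apply/nbhs_ballP; exists (k.+1%:R^-1 - mdist (E j) z) => /=; first by rewrite subr_gt0.
  move=> y; rewrite !ballEmdist/= ltrBrDl; apply: le_lt_trans.
  exact: metric_triangle.
rewrite (_ : [set _ | _] = b i `\` \bigcup_(j in `I_i) b j).
  apply: measurableD => //; apply: bigcup_measurable => *; exact: mb.
apply/seteqP; split => z /=.
- move=> <-; rewrite /quantize; case: ex_minnP => m bm min; split => //.
  by move=> [j /= jm bj]; have := min _ bj; rewrite leqNgt jm.
- move=> [bi nb]; rewrite /quantize; case: ex_minnP => m bm min.
  apply/eqP; rewrite eqn_leq min//= leqNgt; apply/negP => mi.
  by apply: nb; exists m.
Qed.


Definition mcvg (y : nat -> M) (z : M) :=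
  forall e, 0 < e -> \forall k \near \oo, mdist z (y k) < e.

Lemma mcvg_quantize (y : nat -> M) z :
  mcvg y z -> mcvg (fun k => E (quantize k (y k))) z.
Proof.
move=> yz e e0; have e20 : 0 < e / 2 by rewrite divr_gt0.
have near_inv : \forall k \near \oo, k.+1%:R^-1 < e / 2 :> R.
  exact: near_infty_natSinv_lt (PosNum e20).
near=> k; rewrite (splitr e) (le_lt_trans (metric_triangle z (y k) _))// ltrD//.
  by near: k; exact: yz.
rewrite metric_sym (lt_trans (quantize_near _ _))//.
by near: k.
Unshelve. all: by end_near. Qed.

Lemma mcvg_cmap (f : cmap M) (y : nat -> M) z :
  mcvg y z -> mcvg (fun k => f (y k)) (f z).
Proof.
move=> yz e e0.
have /(_ z (ball (f z) e) (nbhsx_ballx _ _ e0)) := @cts_fun _ _ f.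
move=> /nbhs_ballP[r /= r0 Hr].
near=> k.
have : ball z r (y k) by rewrite ballEmdist/=; near: k; exact: yz.
by move=> /Hr; rewrite /= ballEmdist.
Unshelve. all: by end_near. Qed.

(** The bound also forces [Psi] to depend on the first [n] coordinates only, so whole sequences can
    stand for trajectories of length [n]. *)
Definition l1_lipschitz n (a : R) (Psi : (nat -> M) -> R) :=
  forall p q, `|Psi p - Psi q| <= a * \sum_(j < n) mdist (p j) (q j).

Section measurable_functional.
Context d (T : measurableType d).

(** Only countably many trajectories of length [n] occur, so [Psi] itself may be arbitrary. The
    induction slices along the value of the last coordinate. *)
Lemma measurable_discrete_functional n (N : nat -> T -> nat) (Psi : (nat -> M) -> R) :
  (forall j i, measurable [set w | N j w = i]) ->
  (forall p q, (forall j, (j < n)%N -> p j = q j) -> Psi p = Psi q) ->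
  measurable_fun setT (fun w => Psi (fun j => E (N j w))).
Proof.
move=> mN; elim: n Psi => [|n IH] Psi dPsi.
  rewrite (_ : (fun _ => _) = fun=> Psi (fun=> point)); first exact: measurable_cst.
  by apply/funext => w; exact: dPsi.
pose Psi' i p := Psi (fun j => if j == n then E i else p j).
have mPsi' i : measurable_fun setT (fun w => Psi' i (fun j => E (N j w))).
  apply: IH => p q pq; apply: dPsi => j; rewrite ltnS leq_eqVlt.
  by case: eqP => //= _ /pq.
move=> _ B mB; rewrite setTI.
rewrite (_ : _ @^-1` _ = \bigcup_i ([set w | N n w = i] `&`
    (fun w => Psi' i (fun j => E (N j w))) @^-1` B)).
  apply: bigcupT_measurable => i; apply: measurableI => //.
  by rewrite -[_ @^-1` _]setTI; exact: mPsi'.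
have PsiE w : Psi' (N n w) (fun j => E (N j w)) = Psi (fun j => E (N j w)).
  by congr Psi; apply/funext => j; case: eqP => // ->.
apply/seteqP; split=> w /=; first by exists (N n w) => //=; rewrite PsiE.
by move=> [i _ [<-]]; rewrite /= PsiE.
Qed.

(** The functional is the pointwise limit of its values on rounded trajectories, each measurable by
    discreteness. *)
Lemma measurable_l1_lipschitz n a (Psi : (nat -> M) -> R)
    (N : nat -> nat -> T -> nat) (Y : nat -> T -> M) :
  (forall k j i, measurable [set w | N k j w = i]) ->
  (forall j w, mcvg (fun k => E (N k j w)) (Y j w)) ->
  l1_lipschitz n a Psi ->
  measurable_fun setT (fun w => Psi (Y ^~ w)).
Proof.
move=> mN NY lPsi.
apply: (measurable_fun_cvg (h := fun k w => Psi (fun j => E (N k j w)))).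
  move=> k; apply: (measurable_discrete_functional (n := n)) => // p q pq.
  apply/eqP; rewrite -subr_eq0 -normr_le0 (le_trans (lPsi _ _))//.
  by rewrite big1 ?mulr0// => i _; rewrite pq// mdistxx.
move=> w _.
have S0 : (fun k => a * \sum_(j < n) mdist (Y j w) (E (N k j w))) @ \oo --> (0 : R).
  rewrite -[X in _ --> X](mulr0 a); apply: cvgM; first exact: cvg_cst.
  elim: n {lPsi} => [|n IH].
    by under eq_fun do rewrite big_ord0; exact: cvg_cst.
  rewrite [X in X @ _ --> _](_ : _ = (fun k => \sum_(j < n) mdist (Y j w) (E (N k j w)))
    \+ (fun k => mdist (Y n w) (E (N k n w)))); last first.
    by apply/funext => k; rewrite big_ord_recr.
  rewrite -[X in _ --> X](addr0 0).
  apply: cvgD => //; apply/cvgrPdist_lt => e e0.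
  near=> k; rewrite sub0r normrN ger0_norm ?mdist_ge0//; near: k.
  exact: NY.
apply/cvgrPdist_le => e e0.
move/cvgrPdist_le : S0 => /(_ e e0); apply: filterS => k.
rewrite sub0r normrN; apply: le_trans.
exact: le_trans (lPsi _ _) (ler_norm _).
Unshelve. all: by end_near. Qed.

End measurable_functional.

(* Rounding to the dense sequence after every step leaves countably many
   values, so measurability only involves evaluation at fixed points rather
   than the joint map [(f, x) |-> f x]. *)
Fixpoint orbit_code (x : M) k n (w : seq_space (borel (cmap M))) : nat :=
  quantize k (if n is m.+1 then (w m : cmap M) (E (orbit_code x k m w)) else x).

(** Splitting by the previous code [j] leaves an event about the map [w n] evaluated at the fixed
    point [E j]. *)
Lemma measurable_orbit_code x k n i : measurable [set w | orbit_code x k n w = i].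
Proof.
elim: n i => [|n IH] i.
  have [e|ne] := eqVneq (quantize k x) i.
    by rewrite (_ : [set _ | _] = setT)//; apply/seteqP; split.
  rewrite (_ : [set _ | _] = set0)//; apply/seteqP; split => // w /= /eqP.
  by rewrite (negbTE ne).
rewrite (_ : [set _ | _] = \bigcup_j ([set w | orbit_code x k n w = j] `&`
   (fun w : seq_space (borel (cmap M)) => w n) @^-1`
     ((fun f : borel (cmap M) => (f : cmap M) (E j)) @^-1` [set z | quantize k z = i]))).
  apply: bigcupT_measurable => j; apply: measurableI => //.
  rewrite -[X in measurable X]setTI; apply: measurable_coord => //.
  rewrite -[X in measurable X]setTI; apply: measurable_eval => //.
  exact: measurable_quantize.
apply/seteqP; split=> w /=; first by exists (orbit_code x k n w).
by move=> [j _ [/= <-]].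
Qed.

(** For fixed [w] and [n], continuity of each map carries the convergence one step further, and the
    new rounding error tends to zero. *)
Lemma mcvg_orbit_code x n w :
  mcvg (fun k => E (orbit_code x k n w)) (orbit_pt w n x).
Proof.
elim: n => [|n IH]; apply: mcvg_quantize.
  by move=> e e0; near=> k; rewrite mdistxx.
exact: mcvg_cmap.
Unshelve. all: by end_near. Qed.

End discretization.

Section orbit_measurability.
Context {R : realType} {M : pmetricType R}.
Hypothesis cM : compact [set: M].

Lemma measurable_orbit_functional n a (Psi : (nat -> M) -> R) x :
  l1_lipschitz n a Psi ->
  measurable_fun setT (fun w : seq_space (borel (cmap M)) => Psi (fun j => orbit_pt w j x)).
Proof.
have [E dE] := exists_dense_seq cM.
apply: (measurable_l1_lipschitz (E := E) (N := fun k j => orbit_code dE x k j)).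
  by move=> *; exact: measurable_orbit_code.
by move=> *; exact: mcvg_orbit_code.
Qed.

Lemma measurable_orbit_mdist n x y :
  measurable_fun setT (fun w : seq_space (borel (cmap M)) =>
    mdist (orbit_pt w n x) (orbit_pt w n y)).
Proof.
have [E dE] := exists_dense_seq cM.
(* Here the coordinate index enumerates the two starting points instead of times; the distance is
   1-Lipschitz for the l1-distance on pairs. *)
pose z j := if j == 0%N then x else y.
apply: (measurable_l1_lipschitz (E := E) (n := 2) (a := 1)
  (Psi := fun p => mdist (p 0%N) (p 1%N))
  (N := fun k j => orbit_code dE (z j) k n) (Y := fun j w => orbit_pt w n (z j))).
- by move=> *; exact: measurable_orbit_code.
- by move=> *; exact: mcvg_orbit_code.
- move=> p q; rewrite mul1r !big_ord_recl big_ord0 addr0/= ler_norml.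
  have t1 := metric_triangle (p 0%N) (q 0%N) (p 1%N).
  have t2 := metric_triangle (q 0%N) (q 1%N) (p 1%N).
  have t3 := metric_triangle (q 0%N) (p 0%N) (q 1%N).
  have t4 := metric_triangle (p 0%N) (p 1%N) (q 1%N).
  move: t2 t3; rewrite (metric_sym (q 1%N) (p 1%N)) (metric_sym (q 0%N) (p 0%N)).
  rewrite /bump/=; move: t1 t4; lra.
Qed.

End orbit_measurability.

(** * The Kantorovich distance to an empirical measure *)

Section kantorovich_empirical.
Context {R : realType} {M : pmetricType R}.
Hypothesis cM : compact [set: M].

Lemma compact_mdist_bounded : exists D : R, forall x y : M, mdist x y <= D.
Proof.
move: cM; rewrite compact_cover => /(_ nat setT (fun i => (ball (point : M) i.+1%:R)°)).
case.
- by move=> i _; exact: open_interior.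
- move=> z _; have [i iz] : exists i, mdist point z < i.+1%:R.
    exists (Num.truncn (mdist (point : M) z)); exact: truncnS_gt.
  exists i => //; rewrite /interior; apply/nbhs_ballP.
  exists (i.+1%:R - mdist point z) => /=; first by rewrite subr_gt0.
  move=> y; rewrite !ballEmdist/= ltrBrDl; apply: le_lt_trans.
  exact: metric_triangle.
(* The sum of the radii in the finite subcover dominates each of them, and so replaces their
   maximum. *)
move=> K _ Kcov; pose C : R := \sum_(i <- finmap.enum_fset K) i.+1%:R.
have KC (z : M) : mdist point z <= C.
  have [i iK /interior_subset] := Kcov z I.
  rewrite ballEmdist/= => /ltW/le_trans; apply.
  by rewrite /C (big_rem i)//= lerDl sumr_ge0.
exists (C + C) => x y; apply: (le_trans (metric_triangle x point y)).
by rewrite lerD// metric_sym.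
Qed.

Lemma lipschitz_measurable k (g : M -> R) : kLipschitz k g ->
  measurable_fun setT (g : borel M -> R).
Proof.
move=> lg; apply: (@measurability _ _ (borel M) _ setT _ (RGenOInfty.G (R := R))).
  exact: RGenOInfty.measurableE.
move=> _ [_ [r ->] <-]; rewrite setTI; apply: sub_sigma_algebra.
change (open (g @^-1` `]r, +oo[)); rewrite openE => z /=.
rewrite in_itv/= andbT => rz; apply/nbhs_ballP.
(* [k] may be zero or negative; its absolute value plus one is a positive Lipschitz constant by
   which the radius can be divided. *)
have k0 : 0 < `|k| + 1 by rewrite ltr_wpDl.
exists ((g z - r) / (`|k| + 1)) => /=; first by rewrite divr_gt0 ?subr_gt0.
move=> y; rewrite ballEmdist/= in_itv/= andbT => zy.
have := lg z y; rewrite ler_norml => /andP[_ gzy].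
move: zy; rewrite ltr_pdivlMr// => zy.
have := ler_norm k; have := mdist_ge0 z y; nra.
Qed.

Lemma lipschitz_bmeasurable k (g : M -> R) : kLipschitz k g ->
  bmeasurable (g : borel M -> R).
Proof.
move=> lg; split; first exact: (lipschitz_measurable lg).
have [D MD] := compact_mdist_bounded.
exists (`|k| * D + `|g point|) => x.
rewrite -[X in `|X|](subrK (g point)) (le_trans (ler_normD _ _))// lerD2r.
rewrite (le_trans (lg x point))// (le_trans (ler_wpM2r (mdist_ge0 _ _) (ler_norm k)))//.
exact: ler_wpM2l.
Qed.

(** Defined for an arbitrary sequence, so that the Kantorovich distance becomes a function of the
    trajectory; along an orbit it is [empirical]. *)
Definition empirical_of (p : nat -> M) (n : nat) :
    {measure set (borel M) -> \bar R} :=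
  mscale (n%:R^-1)%:nng (msum (fun j => dirac (p j : borel M)) n).

Lemma Rintegral_empirical p n (g : borel M -> R) : measurable_fun setT g ->
  Rintegral (empirical_of p n) setT g = n%:R^-1 * \sum_(j < n) g (p j).
Proof.
move=> mg.
(* The nonnegative case, applied afterwards to the positive and negative parts of [g]. *)
have ge0E (f : borel M -> R) : measurable_fun setT f -> (forall z, 0 <= f z) ->
    (\int[empirical_of p n]_z (f z)%:E)%E = (n%:R^-1 * \sum_(j < n) f (p j))%:E.
  move=> mf f0; have mEf := iffRL (measurable_EFinP setT f) mf.
  rewrite ge0_integral_mscale//; last by move=> z _; rewrite lee_fin.
  rewrite ge0_integral_measure_sum//; last by move=> z _; rewrite lee_fin.
  rewrite EFinM -sumEFin; congr (_ * _)%E; apply: eq_bigr => j _.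
  by rewrite integral_dirac// diracT mul1e.
rewrite /Rintegral integralE.
rewrite (_ : (fun z => (g z)%:E) = EFin \o g)// funerpos funerneg.
rewrite !ge0E//=; [|exact: measurable_funrneg|exact: measurable_funrpos].
rewrite -mulrBr -sumrB; congr (_ * _); apply: eq_bigr => j _.
by rewrite -[in RHS](funrposBneg g).
Qed.

(** For every 1-Lipschitz [g] the empirical average moves by at most the average of the distances;
    this bound does not involve [g] and so passes to the supremum. *)
Lemma l1_lipschitz_kantorovich n (eta : probability (borel M) R) : (0 < n)%N ->
  l1_lipschitz n n%:R^-1 (fun p => kantorovich (empirical_of p n) eta).
Proof.
move=> n0; have n0' : 0 < n%:R :> R by rewrite ltr0n.
have n1 : 0 <= n%:R^-1 :> R by rewrite invr_ge0 ltW.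
have [D MD] := compact_mdist_bounded.
(* The one-sided estimate suffices, by exchanging [p] and [q]. *)
suff H p q : kantorovich (empirical_of p n) eta <=
    kantorovich (empirical_of q n) eta + n%:R^-1 * \sum_(j < n) mdist (p j) (q j).
  move=> p q; rewrite ler_norml; apply/andP; split; last first.
    by rewrite lerBlDl; exact: H.
  rewrite lerNl opprB lerBlDl.
  by under eq_bigr do rewrite metric_sym; exact: H.
have glip (g : M -> R) x y : kLipschitz 1 g -> g x - g y <= mdist x y.
  by move=> /(_ x y); rewrite mul1r; exact: le_trans (ler_norm _).
apply: ge_sup.
  by exists (Rintegral (empirical_of p n) setT (cst 0) - Rintegral eta setT (cst 0)),
    (cst 0) => // x y; rewrite subrr normr0 mul1r mdist_ge0.
move=> _ [g lg <-]; have bg := lipschitz_bmeasurable lg; have [mg _] := bg.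
apply: (@le_trans _ _ (Rintegral (empirical_of q n) setT g - Rintegral eta setT g
    + n%:R^-1 * \sum_(j < n) mdist (p j) (q j))).
  rewrite !Rintegral_empirical// addrAC lerD2r -mulrDr -big_split/=.
  by rewrite ler_wpM2l// ler_sum// => j _; rewrite -lerBlDl; exact: glip.
rewrite lerD2r; apply: ub_le_sup; last by exists g.
(* A real [sup] dominates its elements only when the set is bounded above. As both measures have
   mass 1, the diameter bound [D] serves. *)
exists D => _ [k lk <-]; have bk := lipschitz_bmeasurable lk; have [mk _] := bk.
rewrite Rintegral_empirical//.
rewrite lerBlDr [leRHS](_ : _ = n%:R^-1 * \sum_(j < n) (D + Rintegral eta setT k));
  last by rewrite sumr_const card_ord -[X in _ * X]mulr_natl mulKf// gt_eqF.
rewrite ler_wpM2l//.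
apply: ler_sum => j _; rewrite -lerBlDl -[leLHS](prob_Rintegral_cst eta).
apply: prob_Rintegral_le => // z.
by rewrite lerBlDl -lerBlDr (le_trans (glip _ _ _ lk)).
Qed.

End kantorovich_empirical.

(** * Concentration along orbits *)

Section concentration.
Context {R : realType} {M : pmetricType R}.
Variables (cM : compact [set: M]) (nu : probability (borel (cmap M)) R)
  (P : probability (seq_space (borel (cmap M))) R).
Hypotheses (hP : is_power_law nu P) (wc : (lambda P < +oo)%E).

Local Notation Omega := (seq_space (borel (cmap M))).
Local Notation path x w := (fun j => orbit_pt w j x).

Lemma bmeasurable_orbit_functional n a (Psi : (nat -> M) -> R) x :
  0 <= a -> l1_lipschitz n a Psi -> bmeasurable (fun w : Omega => Psi (path x w)).
Proof.
move=> a0 lPsi; split; first exact: (measurable_orbit_functional cM x lPsi).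
have [D MD] := compact_mdist_bounded cM.
exists (a * \sum_(j < n) D + `|Psi (fun=> x)|) => w.
rewrite -[X in `|X|](subrK (Psi (fun=> x))) (le_trans (ler_normD _ _))// lerD2r.
by rewrite (le_trans (lPsi _ _))// ler_wpM2l// ler_sum.
Qed.

Lemma bmeasurable_orbit_mdist j x y :
  bmeasurable (fun w : Omega => mdist (orbit_pt w j x) (orbit_pt w j y)).
Proof.
split; first exact: measurable_orbit_mdist.
have [D MD] := compact_mdist_bounded cM.
by exists D => w; rewrite ger0_norm ?mdist_ge0.
Qed.

Lemma lambda_ub x y : (\sum_(0 <= j <oo)
  'E_P[fun w : Omega => mdist (orbit_pt w j x) (orbit_pt w j y)] <= lambda P)%E.
Proof. by apply: ereal_sup_ubound; exists (x, y). Qed.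

Lemma lambda_ge0 : (0 <= lambda P)%E.
Proof.
apply: le_trans (lambda_ub point point).
by apply: nneseries_ge0 => *; apply: expectation_ge0 => w; exact: mdist_ge0.
Qed.

Lemma lambda_fin_num : lambda P \is a fin_num.
Proof. by rewrite ge0_fin_numE// lambda_ge0. Qed.

Lemma sum_orbit_mdist_le n x y :
  \sum_(j < n) \int[P]_w mdist (orbit_pt w j x) (orbit_pt w j y) <= fine (lambda P).
Proof.
rewrite -lee_fin fineK ?lambda_fin_num//.
apply: le_trans (lambda_ub x y); rewrite -sumEFin.
apply: le_trans (nneseries_lim_ge n _); last first.
  by move=> *; apply: expectation_ge0 => w; exact: mdist_ge0.
rewrite big_mkord; apply: lee_sum => j _.
rewrite unlock /Rintegral fineK//; apply: integrable_fin_num => //.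
exact: (bmeasurable_integrable P (bmeasurable_orbit_mdist j x y)).
Qed.

Lemma orbit_pt_cons (f : borel (cmap M)) (w : Omega) j x :
  orbit_pt (seq_cons f w) j.+1 x = orbit_pt w j ((f : cmap M) x).
Proof. by elim: j => //= j ->. Qed.

(** Both orbits are driven by the same maps, so the integrated l1-distance is a partial sum of the
    series defining [lambda], bounded independently of [n]. *)
Lemma expectation_orbit_lipschitz n a (Psi : (nat -> M) -> R) x y :
  0 <= a -> l1_lipschitz n a Psi ->
  `|\int[P]_w Psi (path x w) - \int[P]_w Psi (path y w)| <= a * fine (lambda P).
Proof.
move=> a0 lPsi.
have bx := bmeasurable_orbit_functional x a0 lPsi.
have bPy := bmeasurable_orbit_functional y a0 lPsi.
rewrite -RintegralB//; [|exact: bmeasurable_integrable..].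
have bB := bmeasurableB bx bPy.
apply: (le_trans (le_normr_Rintegral measurableT (bmeasurable_integrable P bB))).
pose dd j (w : Omega) := mdist (orbit_pt w j x) (orbit_pt w j y).
have bd j : bmeasurable (dd j) by exact: bmeasurable_orbit_mdist.
have bS := bmeasurable_sum n bd.
apply: (@le_trans _ _ (\int[P]_w (a * \sum_(j < n) dd j w))).
  apply: prob_Rintegral_le; [exact: bmeasurable_norm|exact: bmeasurableM|].
  by move=> w; exact: lPsi.
rewrite RintegralZl//; last exact: (bmeasurable_integrable P bS).
by rewrite prob_Rintegral_sum// ler_wpM2l// sum_orbit_mdist_le.
Qed.

(** Given the first map [f], the rest of the orbit starts at [f x] and the induction hypothesis
    bounds its fluctuation by [K ^+ n] uniformly in [f]. The conditional mean [g f] contributes the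
    last factor [K]. *)
Lemma orbit_mgf_le n a (Psi : (nat -> M) -> R) x s :
  0 <= a -> l1_lipschitz n a Psi ->
  \int[P]_w expR (s * (Psi (path x w) - \int[P]_v Psi (path x v))) <=
    expR (3 * (s * (a * fine (lambda P))) ^+ 2) ^+ n.
Proof.
move=> a0; elim: n Psi x => [|n IH] Psi x lPsi.
  have PsiE p q : Psi p = Psi q.
    apply/eqP; rewrite -subr_eq0 -normr_le0 (le_trans (lPsi p q))//.
    by rewrite big_ord0 mulr0.
  rewrite expr0 -[leRHS](prob_Rintegral_cst P) le_eqVlt; apply/orP; left; apply/eqP.
  apply: eq_Rintegral => w _.
  rewrite (@eq_Rintegral _ _ _ P setT (fun=> Psi (path x w))) ?prob_Rintegral_cst.
    by rewrite subrr mulr0 expR0.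
  by move=> v _; exact: PsiE.
(* The first coordinate is always [x]; freezing it leaves a functional of the shifted orbit with one
   coordinate fewer. *)
pose Psi' p := Psi (fun j => if j is i.+1 then p i else x).
have lPsi' : l1_lipschitz n a Psi'.
  move=> p q; rewrite (le_trans (lPsi _ _))// big_ord_recl/= mdistxx add0r.
  exact: lexx.
have consE (f : borel (cmap M)) (w : Omega) : Psi (path x (seq_cons f w)) = Psi' (path ((f : cmap M) x) w).
  by congr Psi; apply/funext => -[|j] //; exact: orbit_pt_cons.
pose F (w : Omega) := Psi (path x w).
have bF : bmeasurable F := bmeasurable_orbit_functional x a0 lPsi.
pose g (f : borel (cmap M)) := \int[P]_w F (seq_cons f w).
have gE f : g f = \int[P]_w Psi' (path ((f : cmap M) x) w).
  by apply: eq_Rintegral => w _; exact: consE.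
have bg : bmeasurable g := bmeasurable_expectation_cons nu P bF.
have mE : \int[P]_v F v = \int[nu]_f g f := expectation_cons hP bF.
set K := expR _ in IH *.
have bG : bmeasurable (fun w => expR (s * (F w - \int[P]_v F v))).
  apply: bmeasurable_expR; apply: bmeasurableM => //; exact: bmeasurableB.
rewrite -/(F _) (expectation_cons hP bG) mE.
apply: (@le_trans _ _ (\int[nu]_f (K ^+ n * expR (s * (g f - \int[nu]_f g f))))).
  apply: prob_Rintegral_le.
  - by have := bmeasurable_expectation_cons nu P bG; rewrite mE.
  - apply: bmeasurableM => //; apply: bmeasurable_expR; apply: bmeasurableM => //.
    exact: bmeasurableB.
  move=> f.
  have bFf := bmeasurable_seq_cons bF f.
  (* The deviation splits into that from the conditional mean [g f], left to the induction
     hypothesis, and that of [g f] from its own mean, which is constant in [w]. *)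
  rewrite (@eq_Rintegral _ _ _ P setT (fun w => expR (s * (F (seq_cons f w) - g f)) *
      expR (s * (g f - \int[nu]_f g f)))); last first.
    by move=> w _; rewrite -expRD -mulrDr; congr (expR (s * _)); rewrite addrA subrK.
  rewrite RintegralZr//; last first.
    apply: bmeasurable_integrable; apply: bmeasurable_expR; apply: bmeasurableM => //.
    exact: bmeasurableB.
  rewrite ler_wpM2r ?expR_ge0//.
  rewrite (@eq_Rintegral _ _ _ P setT (fun w => expR (s * (Psi' (path ((f : cmap M) x) w)
      - \int[P]_v Psi' (path ((f : cmap M) x) v))))); last first.
    by move=> w _; rewrite -gE /F consE.
  exact: IH.
rewrite RintegralZl//; last first.
  apply: bmeasurable_integrable; apply: bmeasurable_expR; apply: bmeasurableM => //.
  exact: bmeasurableB.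
rewrite exprSr ler_wpM2l ?exprn_ge0 ?expR_ge0//.
(* Changing [f] only changes the starting point of the remaining orbit, so [g] oscillates by at most
   [a * fine (lambda P)]. *)
apply: subgaussian_step => // f f'.
rewrite !gE; exact: expectation_orbit_lipschitz.
Qed.

Lemma orbit_tail_le n (Psi : (nat -> M) -> R) x t :
  (0 < n)%N -> 0 < t -> 0 < fine (lambda P) -> l1_lipschitz n n%:R^-1 Psi ->
  (P [set w : Omega | (t <= Psi (path x w) - \int[P]_v Psi (path x v))%R] <=
    (expR (- (n%:R * t ^+ 2 / (12 * fine (lambda P) ^+ 2))))%:E)%E.
Proof.
move=> n0 t0; set L := fine _ => L0 lPsi.
have n0' : 0 < n%:R :> R by rewrite ltr0n.
have n1 : 0 <= n%:R^-1 :> R by rewrite invr_ge0 ltW.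
have bF := bmeasurable_orbit_functional x n1 lPsi.
set m := \int[P]_v _.
(* The minimizer of the exponent [3 s^2 L^2 / n - s t], with minimum [- n t^2 / (12 L^2)]. *)
pose s := n%:R * t / (6 * L ^+ 2).
have s0 : 0 < s by rewrite divr_gt0 ?mulr_gt0 ?exprn_gt0.
have bFm : bmeasurable (fun w : Omega => Psi (path x w) - m) by exact: bmeasurableB.
apply: (le_trans (chernoff_bounded P t s0 bFm)); rewrite lee_fin.
apply: (le_trans (ler_wpM2r (expR_ge0 _) (orbit_mgf_le x s n1 lPsi))).
rewrite -expRM_natl -expRD ler_expR -/L le_eqVlt; apply/orP; left; apply/eqP.
by rewrite /s; field; rewrite !gt_eqF.
Qed.

(** The one-sided bound for [Psi] and for its opposite, joined by a union bound, which gives the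
    factor 2. *)
Lemma orbit_concentration n (Psi : (nat -> M) -> R) x t :
  (0 < n)%N -> 0 < t -> 0 < fine (lambda P) -> l1_lipschitz n n%:R^-1 Psi ->
  (P [set w : Omega | (t < `|Psi (path x w) - \int[P]_v Psi (path x v)|)%R] <=
    (2 * expR (- (n%:R * t ^+ 2 / (12 * fine (lambda P) ^+ 2))))%:E)%E.
Proof.
move=> n0 t0 L0 lPsi.
have n1 : 0 <= n%:R^-1 :> R by rewrite invr_ge0.
have lNPsi : l1_lipschitz n n%:R^-1 (fun p => - Psi p).
  by move=> p q; rewrite -opprD normrN; exact: lPsi.
have bF := bmeasurable_orbit_functional x n1 lPsi.
have up := orbit_tail_le x n0 t0 L0 lPsi.
have := orbit_tail_le x n0 t0 L0 lNPsi.
have -> : \int[P]_v (- Psi (path x v)) = - \int[P]_v Psi (path x v).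
  rewrite -mulN1r -RintegralZl//; last exact: (bmeasurable_integrable P bF).
  by apply: eq_Rintegral => v _; rewrite mulN1r.
move: up; set m := \int[P]_v _; set e := expR _ => up down.
have mge (G : Omega -> R) : measurable_fun setT G -> measurable [set w | t <= G w].
  move=> mG; rewrite (_ : [set _ | _] = G @^-1` `[t, +oo[); last first.
    by apply/seteqP; split => w /=; rewrite in_itv/= andbT.
  by rewrite -[_ @^-1` _]setTI; exact: mG.
have [mup _] := bmeasurableB bF (@bmeasurable_cst _ _ _ m).
have [mdown _] := bmeasurableB (bmeasurableM (@bmeasurable_cst _ _ _ (- 1)) bF)
  (@bmeasurable_cst _ _ _ (- m)).
have mdown' : measurable [set w : Omega | t <= - Psi (path x w) - - m].
  by have := mge _ mdown; under eq_set do rewrite mulN1r.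
have mabs : measurable [set w : Omega | t < `|Psi (path x w) - m|].
  rewrite (_ : [set _ | _] = (fun w => `|Psi (path x w) - m|) @^-1` `]t, +oo[).
    have [mn _] := bmeasurable_norm (bmeasurableB bF (@bmeasurable_cst _ _ _ m)).
    by rewrite -[_ @^-1` _]setTI; exact: mn.
  by apply/seteqP; split => w /=; rewrite in_itv/= andbT.
apply: (@le_trans _ _ (P ([set w : Omega | t <= Psi (path x w) - m] `|`
    [set w : Omega | t <= - Psi (path x w) - - m]))).
  have mU := measurableU _ _ (mge _ mup) mdown'.
  apply: (le_measure P (mem_set mabs) (mem_set mU)).
  move=> w /=; rewrite ltr_normr => /orP[h|h]; first by left; exact: ltW.
  by right; rewrite -opprD ltW.
apply: (le_trans (measureU2 P (mge _ mup) mdown')).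
by rewrite mulr_natl mulr2n EFinD leeD.
Qed.

(** The term of index 0 in the series is [mdist x y] itself. *)
Lemma lambda0_trivial x y : fine (lambda P) = 0 -> x = y :> M.
Proof.
move=> L0; apply: mdist_positivity; apply/eqP; rewrite eq_le mdist_ge0 andbT -L0.
by have := sum_orbit_mdist_le 1 x y; rewrite big_ord1/= prob_Rintegral_cst.
Qed.

End concentration.

(** * Signs of the constants and the deviation inequality *)

Lemma rho_diam_ge0 (R : realType) (M : pmetricType R) (G : set (cmap M)) (f : cmap M) :
  G f -> (0 <= rho_diam G)%E.
Proof.
move=> Gf; apply: (@le_trans _ _ (rho f f)).
  apply: (@le_trans _ _ (mdist (f point) (f point))%:E); first by rewrite mdistxx.
  by apply: ereal_sup_ubound; exists point.
by apply: ereal_sup_ubound; exists f => //; exists f.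
Qed.

Lemma lip_const_ge0 (R : realType) (M : pmetricType R) (h : M -> R) : 0 <= lip_const h.
Proof.
rewrite /lip_const; set S := [set z | _].
have S0 z : S z -> 0 <= z by move=> [x [y [_ ->]]]; rewrite divr_ge0// mdist_ge0.
(* When no supremum exists, [sup] takes the default value 0. *)
have [hs|hs] := pselect (has_sup S); last by rewrite sup_out.
by have [[z Sz] ub] := hs; exact: le_trans (S0 z Sz) (ub_le_sup ub Sz).
Qed.

Local Open Scope ereal_scope.

Theorem proposition5 (R : realType) (M : pmetricType R)
    (cM : compact [set: M])
    (nu : probability (borel (cmap M)) R)
    (P : probability (seq_space (borel (cmap M))) R)
    (hP : is_power_law nu P)
    (bG : rho_diam (topo_support nu) < +oo)
    (wc : lambda P < +oo)
    (eta : probability (borel M) R) (heta : stationary nu eta)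
    (h : M -> R) (hh : Lipschitz h) (x : M) (n : nat) (n0 : (0 < n)%N) (t : R)
    (ht : 2%:E * lambda P * (lip_const h)%:E / n%:R%:E < t%:E) :
  P [set w | t%:E < `| (kantorovich (empirical w n x) eta)%:E
                       - 'E_P[fun w => kantorovich (empirical w n x) eta] |]
  <= 2%:E * expeR (- ((n%:R * t ^+ 2)%:E /
                      (12%:E * (rho_diam (topo_support nu) + lambda P) ^+ 2))).
Proof.
have Lfin := lambda_fin_num wc; have Lge0 := lambda_ge0 P.
have n0' : (0 < n%:R :> R)%R by rewrite ltr0n.
have n1 : (0 <= n%:R^-1 :> R)%R by rewrite invr_ge0.
have t0 : (0 < t)%R.
  (* The threshold in [ht] is nonnegative, so [t] is positive. *)
  rewrite -lte_fin; apply: le_lt_trans ht.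
  rewrite -(fineK Lfin) inver gt_eqF//= -!EFinM lee_fin.
  by rewrite !mulr_ge0 ?fine_ge0 ?lip_const_ge0.
pose Psi p := kantorovich (empirical_of p n) eta.
have lPsi : l1_lipschitz n n%:R^-1 Psi by exact: l1_lipschitz_kantorovich.
have bF := bmeasurable_orbit_functional cM x n1 lPsi.
have -> : 'E_P[fun w => kantorovich (empirical w n x) eta] =
    (\int[P]_w Psi (fun j => orbit_pt w j x))%R%:E.
  rewrite unlock /Rintegral fineK//; apply: integrable_fin_num => //.
  exact: (bmeasurable_integrable P bF).
set m := Rintegral _ _ _.
rewrite [X in P X](_ : _ = [set w |
    (t < `|Psi (fun j => orbit_pt w j x) - m|)%R]); last first.
  by apply/seteqP; split => w /=; rewrite lte_fin.
(* [x / 0 = +oo] for [0 < x]: when [lambda P = 0] the right-hand side may vanish *)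
have [L0|L0] := eqVneq (fine (lambda P)) 0%R.
  (* Here [M] is a single point, the functional equals its mean and the event is empty. *)
  rewrite (_ : [set w | _] = set0) ?measure0 ?mule_ge0 ?expeR_ge0//.
  apply/seteqP; split => // w /=; rewrite /m.
  rewrite (@eq_Rintegral _ _ _ P setT (fun=> Psi (fun j => orbit_pt w j x))); last first.
    by move=> v _; congr Psi; apply/funext => j; exact: (lambda0_trivial cM wc).
  by rewrite prob_Rintegral_cst subrr normr0 ltNge (ltW t0).
have {}L0 : (0 < fine (lambda P))%R by rewrite lt_neqAle eq_sym L0 fine_ge0.
apply: (le_trans (orbit_concentration cM hP wc x n0 t0 L0 lPsi)).
rewrite EFinM lee_pmul2l// -[(expR _)%:E]/(expeR _%:E) lee_expeR.
have [[f Gf]|noG] := pselect (exists f, topo_support nu f); last first.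
  (* [ereal_sup set0 = -oo], and then [(-oo) ^+ 2 = +oo] makes the exponent 0 *)
  have -> : rho_diam (topo_support nu) = -oo.
    rewrite /rho_diam (_ : [set rho f g | f in _ & g in _] = set0) ?ereal_sup0//.
    by apply/seteqP; split => // z [f Gf]; case: noG; exists f.
  rewrite addNye expe2 mulNyNy gt0_muley// invey mule0 oppe0 lee_fin.
  by rewrite oppr_le0; apply: divr_ge0; apply: mulr_ge0 => //; exact: sqr_ge0.
have D0 := rho_diam_ge0 Gf.
have Dfin : rho_diam (topo_support nu) \is a fin_num by rewrite ge0_fin_numE.
rewrite -(fineK Dfin) -(fineK Lfin); move: (fine_ge0 D0) L0.
move: (fine (rho_diam (topo_support nu))) (fine (lambda P)) => D L D0' L0.
have DL : (0 < D + L)%R by rewrite ltr_wpDl.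
rewrite -EFinD -EFin_expe -EFinM inver gt_eqF ?mulr_gt0 ?exprn_gt0//.
rewrite -EFinM -EFinN lee_fin lerN2.
(* As [0 <= D], replacing [L] by [D + L] only enlarges the denominator and weakens the bound. *)
apply: ler_wpM2l; first by apply: mulr_ge0 => //; exact: sqr_ge0.
rewrite lef_pV2 ?posrE ?mulr_gt0 ?exprn_gt0// ler_pM2l//.
by apply: lerXn2r; rewrite ?nnegrE ?lerDr// ltW.
Qed.
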